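(* For every fixed integer $k \ge 1$, there are only finitely many (up to isomorphism) $k$-vertex-critical $(P_5, K_{1,4}+P_1)$-free graphs.
   Context: All graphs are finite, simple and undirected. $P_t$ denotes the path on $t$ vertices, $K_{r,s}$ the complete bipartite graph with parts of sizes $r$ and $s$, and $G+H$ the disjoint union of graphs $G$ and $H$ (so $K_{1,4}+P_1$ is the disjoint union of the star $K_{1,4}$ and an isolated vertex). A graph is $(H_1,H_2)$-free if it contains no induced subgraph isomorphic to $H_1$ or to $H_2$. A graph $G$ is $k$-vertex-critical if $\chi(G)=k$ and $\chi(G-v)<k$ for every vertex $v\in V(G)$, where $\chi$ is the chromatic number. *)

(* Defs.v *)
From mathcomp Require Import all_boot.

Set Implicit Arguments.
Unset Strict Implicit.
Unset Printing Implicit Defensive.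

Record sgraph := SGraph {
  vertex :> finType;
  adj : rel vertex;
  adj_sym : symmetric adj;
  adj_irr : irreflexive adj
}.

Definition iso (G H : sgraph) : Prop :=
  exists2 f : G -> H, bijective f & forall x y, adj (f x) (f y) = adj x y.

Section Induced.
Variables (G : sgraph) (A : {set G}).

Definition induced_adj : rel {x : G | x \in A} :=
  [rel x y | adj (val x) (val y)].

Lemma induced_adj_sym : symmetric induced_adj.
Proof. by move=> x y; apply: adj_sym. Qed.

Lemma induced_adj_irr : irreflexive induced_adj.
Proof. by move=> x; apply: adj_irr. Qed.

Definition induced := SGraph induced_adj_sym induced_adj_irr.
End Induced.

Definition del_vertex (G : sgraph) (v : G) : sgraph := induced [set~ v].

Definition is_free (H G : sgraph) : Prop :=
  ~ exists A : {set G}, iso (induced A) H.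

Section Path.
Variable t : nat.

Definition path_adj : rel 'I_t := [rel i j : 'I_t | (i.+1 == j) || (j.+1 == i)].

Lemma path_adj_sym : symmetric path_adj.
Proof. by move=> i j; rewrite /path_adj /= orbC. Qed.

Lemma path_adj_irr : irreflexive path_adj.
Proof. by move=> i; rewrite /path_adj /= orbb gtn_eqF. Qed.

Definition path_graph := SGraph path_adj_sym path_adj_irr.
End Path.

Section CompleteBipartite.
Variables r s : nat.

Definition biclique_adj : rel ('I_r + 'I_s)%type :=
  fun u v => match u, v with
             | inl _, inr _ | inr _, inl _ => true
             | _, _ => false
             end.

Lemma biclique_adj_sym : symmetric biclique_adj.
Proof. by case=> ? [] ?. Qed.

Lemma biclique_adj_irr : irreflexive biclique_adj.
Proof. by case. Qed.

Definition biclique := SGraph biclique_adj_sym biclique_adj_irr.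
End CompleteBipartite.

Section DisjointUnion.
Variables G H : sgraph.

Definition union_adj : rel (G + H)%type :=
  fun u v => match u, v with
             | inl x, inl y => adj x y
             | inr x, inr y => adj x y
             | _, _ => false
             end.

Lemma union_adj_sym : symmetric union_adj.
Proof. by case=> x [] y //=; rewrite adj_sym. Qed.

Lemma union_adj_irr : irreflexive union_adj.
Proof. by case=> x /=; rewrite adj_irr. Qed.

Definition disjoint_union := SGraph union_adj_sym union_adj_irr.
End DisjointUnion.

Definition colorable (G : sgraph) (k : nat) : bool :=
  [exists c : {ffun G -> 'I_k},
    [forall x, forall y, adj x y ==> (c x != c y)]].

Lemma colorable_exists (G : sgraph) : exists k, colorable G k.
Proof.
exists #|G|; apply/existsP; exists [ffun x => enum_rank x].
apply/forallP => x; apply/forallP => y; apply/implyP; rewrite !ffunE.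
by apply: contraTneq => /enum_rank_inj ->; rewrite adj_irr.
Qed.

Definition chromatic_number (G : sgraph) : nat := ex_minn (colorable_exists G).

Definition vertex_critical (k : nat) (G : sgraph) : Prop :=
  chromatic_number G = k /\
  forall v : G, chromatic_number (del_vertex v) < k.

(* The family need not be irredundant and its members need not satisfy P. *)
Definition finitely_many_up_to_iso (P : sgraph -> Prop) : Prop :=
  exists (n : nat) (F : 'I_n -> sgraph),
    forall G : sgraph, P G -> exists i : 'I_n, iso G (F i).

(* Main.v *)
Require Import Defs.
From mathcomp Require Import all_boot.
From mathcomp Require Import zify.

(** Let [G] be such a graph; its cliques have at most [k] vertices. If [u] and
    [v] are not adjacent, [N(v) \ N(u)] contains no stable set of size 4 (that
    would give K_{1,4}+P_1), so by Ramsey's theorem its size is bounded. A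
    shortest path in the complement of [G] yields, through every second vertex,
    a clique of [G], so the components of the complement have bounded diameter.
    Hence any two vertices of such a component [X] have almost the same
    neighbours; a vertex with many neighbours in [X] would then produce a large
    clique, and [G[X]] has bounded degree. Criticality forces [G[X]] to be
    connected, because [X] is complete to the rest of [G], and P_5-freeness then
    bounds [X]. As every vertex misses boundedly many others, a large [G] would
    again contain a large clique. *)

Set Implicit Arguments.
Unset Strict Implicit.
Unset Printing Implicit Defensive.

(** Serves to rename colours injectively when two colourings of a critical graph are merged. *)
Lemma exists_injection_in (T : finType) (A B : {set T}) :
  #|A| <= #|B| ->
  exists f : T -> T, {in A, forall x, f x \in B} /\ {in A &, injective f}.
Proof.
move=> leAB; exists (fun x => nth x (enum B) (index x (enum A))).
have idx x : x \in A -> index x (enum A) < size (enum B).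
  by move=> xA; rewrite -cardE (leq_trans _ leAB) // cardE index_mem mem_enum.
split=> [x xA|x y xA yA]; first by rewrite -mem_enum mem_nth ?idx.
rewrite (set_nth_default y) ?idx // => /eqP.
rewrite nth_uniq ?enum_uniq ?idx // => /eqP eqi.
by rewrite -[x](nth_index x (s := enum A)) ?mem_enum // eqi nth_index ?mem_enum.
Qed.

(** * Cliques, stable sets and forbidden induced subgraphs *)

Section Graph.
Variable G : sgraph.
Implicit Types (u v w x y : G) (A B Q S X Y : {set G}).

Definition nbr x : {set G} := [set y | adj x y].
Definition clique Q := {in Q &, forall x y, x != y -> adj x y}.
Definition stable Q := {in Q &, forall x y, ~~ adj x y}.

(** Reduces exhibiting a forbidden subgraph to giving a map; its corestriction to the image is
    bijective by counting. *)
Lemma embedding_not_free (H : sgraph) (f : H -> G) :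
  injective f -> (forall s t, adj (f s) (f t) = adj s t) -> ~ is_free H G.
Proof.
move=> f_inj f_adj; apply; exists (f @: [set: H]).
have fA t : f t \in f @: [set: H] by rewrite imset_f.
pose h t : induced (f @: [set: H]) := exist _ (f t) (fA t).
have h_inj : injective h by move=> x y /(congr1 val)/f_inj.
have [|g hg gh] := inj_card_bij h_inj; last first.
  exists g; first by exists h.
  move=> x y; rewrite -f_adj.
  by rewrite -[f (g x)]/(val (h (g x))) -[f (g y)]/(val (h (g y))) !gh.
by rewrite card_sig -[leqRHS]cardsT -(card_imset _ f_inj) subset_leq_card //; apply/subsetP.
Qed.

Lemma cliqueU1 x Q : Q \subset nbr x -> clique Q -> clique (x |: Q).
Proof.
move=> /subsetP sQ cQ y z /setU1P[->|yQ] /setU1P[->|zQ]; rewrite ?eqxx //.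
- by move=> _; have := sQ z zQ; rewrite inE.
- by move=> _; have := sQ y yQ; rewrite inE adj_sym.
- exact: cQ.
Qed.

(** Fix [x] in [S]: its neighbours or its non-neighbours in [S] reach half of the bound, and [x]
    extends a clique found in the former or a stable set found in the latter. *)
Lemma ramsey a b S : 2 ^ (a + b) <= #|S| ->
  (exists2 Q : {set G}, Q \subset S & clique Q /\ #|Q| = a) \/
  (exists2 Q : {set G}, Q \subset S & stable Q /\ #|Q| = b).
Proof.
elim: a b S => [|a IHa] b S.
  by move=> _; left; exists set0; rewrite ?sub0set // cards0; split=> // x; rewrite inE.
elim: b S => [|b IHb] S.
  by move=> _; right; exists set0; rewrite ?sub0set // cards0; split=> // x; rewrite inE.
move=> le_S.
have /card_gt0P[x xS] : 0 < #|S| by rewrite (leq_trans _ le_S) // expn_gt0.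
have card_S : #|S| = 1 + #|S :&: nbr x| + #|(S :\ x) :\: nbr x|.
  have -> : S :&: nbr x = (S :\ x) :&: nbr x.
    by apply/setP=> y; rewrite !inE; case: eqP => // ->; rewrite adj_irr andbF.
  by rewrite -addnA cardsID (cardsD1 x S) xS.
have [le1|lt1] := leqP (2 ^ (a + b.+1)) #|S :&: nbr x|.
  have [] := IHa _ _ le1 => -[Q sQ [cQ card_Q]]; last first.
    by right; exists Q => //; apply: subset_trans sQ (subsetIl _ _).
  left; have /subsetP sQS := subset_trans sQ (subsetIl _ _).
  have sQx := subset_trans sQ (subsetIr _ _).
  exists (x |: Q).
    by apply/subsetP=> y /setU1P[->//|]; apply: sQS.
  split; first exact: cliqueU1.
  rewrite cardsU1 card_Q; case: (boolP (x \in Q)) => // xQ.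
  by have := subsetP sQx x xQ; rewrite inE adj_irr.
have le2 : 2 ^ (a.+1 + b) <= #|(S :\ x) :\: nbr x|.
  by move: le_S lt1; rewrite card_S [a.+1 + b]addSnnS [a.+1 + _]addSn expnS; lia.
have [] := IHb _ le2 => -[Q sQ [cQ card_Q]].
  left; exists Q => //; apply: subset_trans sQ _.
  by apply: subset_trans (subsetDl _ _) (subsetDl _ _).
right; have sQ' y : y \in Q -> [&& y \in S, y != x & ~~ adj x y].
  by move=> /(subsetP sQ); rewrite !inE => /and3P[-> -> ->].
exists (x |: Q).
  by apply/subsetP=> y /setU1P[->//|/sQ' /and3P[]].
split; last first.
  rewrite cardsU1 card_Q; case: (boolP (x \in Q)) => // /sQ'.
  by rewrite eqxx andbF.
move=> y z /setU1P[->|yQ] /setU1P[->|zQ]; rewrite ?adj_irr //.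
- by have /and3P[] := sQ' z zQ.
- by rewrite adj_sym; have /and3P[] := sQ' y yQ.
- exact: cQ.
Qed.

(** Choosing a vertex and keeping only its neighbours discards at most [M] vertices, the chosen one
    included. *)
Lemma greedy_clique M q S :
  {in S, forall u, #|S :\: nbr u| <= M} -> q * M < #|S| ->
  exists2 Q : {set G}, Q \subset S & clique Q /\ #|Q| = q.+1.
Proof.
elim: q S => [|q IHq] S miss lt_S.
  have /card_gt0P[x xS] := lt_S; exists [set x]; rewrite ?sub1set //.
  by rewrite cards1; split=> // y z /set1P-> /set1P->; rewrite eqxx.
have /card_gt0P[x xS] : 0 < #|S| by apply: leq_ltn_trans lt_S.
have [||Q sQ [cQ card_Q]] := IHq (S :&: nbr x).
- move=> u /setIP[uS _]; apply: leq_trans (miss u uS).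
  by apply: subset_leq_card; apply: setSD; apply: subsetIl.
- by move: lt_S (miss x xS); rewrite -(cardsID (nbr x) S) mulSn; lia.
have sQx := subset_trans sQ (subsetIr _ _).
have sQS := subset_trans sQ (subsetIl _ _).
exists (x |: Q); first by rewrite subUset sub1set xS.
split; first exact: cliqueU1.
rewrite cardsU1 card_Q; case: (boolP (x \in Q)) => // xQ.
by have := subsetP sQx x xQ; rewrite inE adj_irr.
Qed.

Lemma card_clique_colorable k Q : colorable G k -> clique Q -> #|Q| <= k.
Proof.
move=> /existsP[c /forallP c_col] cQ.
have c_inj : {in Q &, injective c}.
  move=> x y xQ yQ /eqP eq_c; apply: contraTeq eq_c => /(cQ x y xQ yQ) xy.
  by move/forallP: (c_col x) => /(_ y)/implyP; apply.
by rewrite -(card_in_imset c_inj) -[k in leqRHS]card_ord max_card.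
Qed.

Lemma star_free_nbrD k u v :
  is_free (disjoint_union (biclique 1 4) (path_graph 1)) G ->
  (forall Q, clique Q -> #|Q| <= k) ->
  ~~ adj u v -> #|nbr v :\: nbr u| <= 2 ^ (k.+1 + 4).
Proof.
move=> Gfree omega nuv; rewrite leqNgt; apply/negP => /ltnW /ramsey[].
  by case=> Q _ [/omega le_Q card_Q]; rewrite card_Q ltnn in le_Q.
case=> Q sQ [stQ card_Q].
have Qadj x : x \in Q -> adj v x && ~~ adj u x.
  by move/(subsetP sQ); rewrite !inE andbC.
have [e e_inj eQ] : exists2 e : 'I_4 -> G, injective e & forall i, e i \in Q.
  rewrite -card_Q; exists (fun i => enum_val i); first exact: enum_val_inj.
  exact: enum_valP.
(* The hypothesis allows [u = v], but a member of [Q] is adjacent to [v] and not to [u]. *)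
have vu : v != u.
  apply: contraTneq (Qadj _ (eQ ord0)) => ->.
  by case: (adj u _).
have ve i : v != e i.
  by apply: contraTneq (Qadj _ (eQ i)) => ->; rewrite adj_irr.
have ue i : u != e i.
  by apply: contraTneq (Qadj _ (eQ i)) => <-; rewrite adj_sym (negbTE nuv).
pose f (t : disjoint_union (biclique 1 4) (path_graph 1)) : G :=
  match t with inl (inl _) => v | inl (inr i) => e i | inr _ => u end.
apply: (@embedding_not_free _ f) Gfree.
  case=> [[i|i]|i] [[j|j]|j] //= /eqP; rewrite ?(negbTE vu) ?(negbTE (ve _)) //.
  - by rewrite (ord1 i) (ord1 j).
  - by rewrite eq_sym (negbTE (ve _)).
  - by move=> /eqP/e_inj->.
  - by rewrite eq_sym (negbTE (ue _)).
  - by rewrite eq_sym (negbTE vu).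
  - by rewrite (negbTE (ue _)).
  - by rewrite (ord1 i) (ord1 j).
have av i : adj v (e i) by have /andP[] := Qadj _ (eQ i).
have au i : adj u (e i) = false by apply: negbTE; have /andP[] := Qadj _ (eQ i).
case=> [[i|i]|i] [[j|j]|j] //=; rewrite ?adj_irr ?av ?au //.
- by rewrite adj_sym (negbTE nuv).
- by rewrite adj_sym av.
- by rewrite (negbTE (stQ _ _ (eQ i) (eQ j))).
- by rewrite adj_sym au.
- by rewrite (negbTE nuv).
- by rewrite (ord1 i) (ord1 j).
Qed.

(** * Balls in the complement graph *)

Fixpoint coball n v : {set G} :=
  if n is m.+1 then [set y | [exists x in coball m v, ~~ adj x y]] else [set v].

Lemma coball_step n v x y : x \in coball n v -> ~~ adj x y -> y \in coball n.+1 v.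
Proof. by move=> xB nxy; rewrite inE; apply/existsP; exists x; rewrite xB. Qed.

(** By irreflexivity every vertex counts as its own non-neighbour. *)
Lemma coballS n v : coball n v \subset coball n.+1 v.
Proof. by apply/subsetP=> x xB; apply: coball_step xB _; rewrite adj_irr. Qed.

Lemma coball_center n v : v \in coball n v.
Proof. by elim: n => [|n IHn]; [rewrite inE | apply: (subsetP (coballS _ _))]. Qed.

(** Such an [X] is a union of components of the complement, hence complete to the rest of the
    graph. *)
Definition coclosed X := forall x y, x \in X -> ~~ adj x y -> y \in X.

(* A vertex at distance [2j + 2] from [v] in the complement of [G] is adjacent
   to the whole coball of radius [2j], so it extends a clique found there. *)
Lemma coball_closed_or_clique v j :
  coclosed (coball j.*2 v) \/
  exists2 Q : {set G}, Q \subset coball j.*2 v & clique Q /\ #|Q| = j.+1.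
Proof.
elim: j => [|j [IHj|[Q sQ [cQ card_Q]]]].
- right; exists [set v] => //; rewrite cards1; split=> // x y /set1P-> /set1P->.
  by rewrite eqxx.
- have stab n : coclosed (coball n v) -> coball n.+1 v = coball n v.
    move=> cl; apply/eqP; rewrite eqEsubset coballS andbT.
    by apply/subsetP=> y; rewrite inE => /exists_inP[x xB /cl]; apply.
  by left; rewrite doubleS !stab // ?stab.
rewrite doubleS; have [sB|/subsetPn[x xB xB']] :=
  boolP (coball j.*2.+2 v \subset coball j.*2.+1 v).
  left=> x y xB nxy; apply: (subsetP (coballS _ _)).
  by apply: (subsetP sB); apply: coball_step nxy; apply: (subsetP sB).
right; have sQx : Q \subset nbr x.
  apply/subsetP=> y yQ; rewrite inE adj_sym; apply: contraNT xB'.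
  by apply: coball_step; apply: (subsetP sQ).
exists (x |: Q).
  rewrite subUset sub1set xB (subset_trans sQ) //.
  exact: subset_trans (coballS _ _) (coballS _ _).
split; first exact: cliqueU1.
rewrite cardsU1 card_Q; case: (boolP (x \in Q)) => // xQ.
by have := subsetP sQx x xQ; rewrite inE adj_irr.
Qed.

Lemma card_setD_triangle A B X : #|A :\: X| <= #|A :\: B| + #|B :\: X|.
Proof.
apply: leq_trans (subset_leq_card _) (leq_card_setU _ _).
by apply/subsetP=> x; rewrite !inE; case: (x \in B) => /andP[-> ->].
Qed.

(** Each step of a walk along non-edges changes the neighbourhood by at most [R] in either
    direction. *)
Lemma coball_nbrD R n v u :
  (forall x y, ~~ adj x y -> #|nbr y :\: nbr x| <= R) ->
  u \in coball n v ->
  #|nbr v :\: nbr u| <= n * R /\ #|nbr u :\: nbr v| <= n * R.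
Proof.
move=> near; elim: n u => [|n IHn] u; first by move=> /set1P->; rewrite setDv cards0.
rewrite inE => /exists_inP[x /IHn[vx xv] nxu].
have nux : ~~ adj u x by rewrite adj_sym.
split; rewrite mulSn.
  apply: leq_trans (card_setD_triangle _ (nbr x) _) _; rewrite addnC.
  by apply: leq_add vx; apply: near.
apply: leq_trans (card_setD_triangle _ (nbr x) _) _.
by apply: leq_add xv; apply: near.
Qed.

(** Neighbourhoods in the coball are compared through the centre [v], whence the doubling; too many
    neighbours of [u] would yield a clique on [k.+1] vertices greedily. *)
Lemma coball_degree k R n v u :
  (forall Q, clique Q -> #|Q| <= k) ->
  (forall x y, ~~ adj x y -> #|nbr y :\: nbr x| <= R) ->
  u \in coball n v -> #|nbr u :&: coball n v| <= k * (n * R).*2.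
Proof.
move=> omega near uB; rewrite leqNgt; apply/negP => /greedy_clique[|Q _ [/omega]].
  move=> w /setIP[_ wB]; apply: leq_trans (_ : #|nbr u :\: nbr w| <= _).
    by apply: subset_leq_card; apply: setSD; apply: subsetIl.
  apply: leq_trans (card_setD_triangle _ (nbr v) _) _; rewrite -addnn.
  have [vw _] := coball_nbrD near wB; have [_ uv] := coball_nbrD near uB.
  exact: leq_add.
by move=> le_Q card_Q; rewrite card_Q ltnn in le_Q.
Qed.

(** * Balls in the subgraph induced on a vertex set *)

Fixpoint ball X n v : {set G} :=
  if n is m.+1 then
    ball X m v :|: [set y in X | [exists x in ball X m v, adj x y]]
  else [set v].

Lemma ball_step X n v x y :
  x \in ball X n v -> y \in X -> adj x y -> y \in ball X n.+1 v.
Proof.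
move=> xB yX xy; rewrite !inE yX /=; apply/orP; right.
by apply/existsP; exists x; rewrite xB.
Qed.

Lemma ball_sub X n v : v \in X -> ball X n v \subset X.
Proof.
move=> vX; elim: n => [|n IHn] /=; first by rewrite sub1set.
by rewrite subUset IHn; apply/subsetP=> y; rewrite inE => /andP[].
Qed.

Lemma ball_center X n v : v \in ball X n v.
Proof. by elim: n => [|n IHn]; rewrite !inE ?IHn. Qed.

Lemma ball_pred X n v y : y \in ball X n.+2 v -> y \notin ball X n.+1 v ->
  exists x, [/\ x \in ball X n.+1 v, x \notin ball X n v & adj x y].
Proof.
move=> /setUP[->//|]; rewrite inE => /andP[yX /exists_inP[x xB xy]] yB.
exists x; split=> //; apply: contra yB => xB'; exact: ball_step xy.
Qed.

Lemma ball_far X n v x y : x \in ball X n v -> y \in X ->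
  y \notin ball X n.+1 v -> ~~ adj x y.
Proof. by move=> xB yX; apply: contra; apply: ball_step. Qed.

(** A shortest path inside [X] to a vertex at distance 4 from [v] would be an induced $P_5$. *)
Lemma P5_free_ball X v : v \in X -> is_free (path_graph 5) G ->
  ball X 4 v \subset ball X 3 v.
Proof.
move=> vX Gfree; apply/subsetP=> x4 x4B; apply/negPn/negP=> x4N.
have [x3 [x3B x3N a34]] := ball_pred x4B x4N.
have [x2 [x2B x2N a23]] := ball_pred x3B x3N.
have [x1 [x1B x1N a12]] := ball_pred x2B x2N.
have a01 : adj v x1.
  move: x1B x1N; rewrite in_setU => /orP[->//|].
  by rewrite inE => /andP[_ /exists_inP[z /set1P->]].
have sX n := subsetP (ball_sub n vX).
have n02 : ~~ adj v x2 by apply: (@ball_far X 0 v) => //; [apply: ball_center | apply: (sX 2)].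
have n13 : ~~ adj x1 x3 by apply: (@ball_far X 1 v) => //; apply: (sX 3).
have n24 : ~~ adj x2 x4 by apply: (@ball_far X 2 v) => //; apply: (sX 4).
have n03 : ~~ adj v x3.
  by apply: (@ball_far X 1 v) => //; [apply: ball_center | apply: (sX 3)].
have n04 : ~~ adj v x4.
  by apply: (@ball_far X 2 v) => //; [apply: ball_center | apply: (sX 4)].
have n14 : ~~ adj x1 x4.
  by apply: (@ball_far X 2 v) => //; [rewrite inE x1B | apply: (sX 4)].
pose s := [:: v; x1; x2; x3; x4].
pose f (i : path_graph 5) := nth v s i.
have f_adj i j : adj (f i) (f j) = adj i j.
  have sf x y : adj x y -> adj y x by rewrite adj_sym.
  have nf x y : ~~ adj x y -> adj x y = false /\ adj y x = false.
    by rewrite [adj y x]adj_sym => /negbTE->.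
  move: (n02) (n13) (n24) (n03) (n04) (n14).
  move=> /nf[? ?] /nf[? ?] /nf[? ?] /nf[? ?] /nf[? ?] /nf[? ?].
  case: i => [[|[|[|[|[|i]]]]] //= ?]; case: j => [[|[|[|[|[|j]]]]] //= ?];
    rewrite /f /= ?adj_irr //; by [|apply: sf].
apply: (@embedding_not_free _ f) Gfree => // i j eq_f.
(* Injectivity: vertices of $P_5$ are told apart by their adjacencies to the vertices 0 to 3. *)
have key l : adj i l = adj j l by rewrite -!f_adj eq_f.
move: (key (@inord 4 0)) (key (@inord 4 1)) (key (@inord 4 2)) (key (@inord 4 3)).
case: i {eq_f key} => [[|[|[|[|[|i]]]]] //= ?]; case: j => [[|[|[|[|[|j]]]]] //= ?];
  rewrite /path_adj /= ?inordK //= => *; by [apply: val_inj|].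
Qed.

Lemma card_ball X n v D : v \in X ->
  {in X, forall u, #|nbr u :&: X| <= D} -> #|ball X n v| <= D.+1 ^ n.
Proof.
move=> vX deg; elim: n => [|n IHn] /=; first by rewrite cards1.
apply: leq_trans (leq_card_setU _ _) _; rewrite expnS mulSn.
apply: leq_add => //; apply: leq_trans (leq_mul (leqnn D) IHn).
apply: leq_trans (subset_leq_card _) (_ : #|\bigcup_(x in ball X n v) (nbr x :&: X)| <= _).
  apply/subsetP=> y; rewrite inE => /andP[yX /exists_inP[x xB xy]].
  by apply/bigcupP; exists x; rewrite // !inE xy.
apply: leq_trans (_ : \sum_(x in ball X n v) #|nbr x :&: X| <= _).
  elim/big_rec2: _ => [|x m S xB le_S]; first by rewrite cards0.
  exact: leq_trans (leq_card_setU _ _) (leq_add _ _).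
rewrite mulnC -sum_nat_const; apply: leq_sum => x xB.
by apply: deg; apply: (subsetP (ball_sub n vX)).
Qed.

End Graph.

(** * Colourings of vertex-critical graphs *)

Lemma colorableW (H : sgraph) m n : m <= n -> colorable H m -> colorable H n.
Proof.
move=> le_mn /existsP[c /forallP c_col]; apply/existsP.
exists [ffun x => widen_ord le_mn (c x)]; apply/forallP=> x; apply/forallP=> y.
move/forallP: (c_col x) => /(_ y)/implyP cxy; apply/implyP=> /cxy; rewrite !ffunE.
by apply: contraNneq => /(congr1 val)/= /val_inj->.
Qed.

Section Critical.
Variables (k : nat) (G : sgraph).
Hypothesis G_crit : vertex_critical k G.

Lemma critical_colorable : colorable G k.
Proof. by case: G_crit; rewrite /chromatic_number; case: ex_minnP => m + _ <-. Qed.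

Lemma critical_not_colorable m : colorable G m -> k <= m.
Proof. by case: G_crit; rewrite /chromatic_number; case: ex_minnP => n _ min_n <- _; apply: min_n. Qed.

(** The vertex [a] only supplies a default: [proj] sends [b] to it, which makes the colouring total
    on [G]. *)
Lemma critical_del_coloring (a b : G) : a != b -> exists c : G -> 'I_k.-1,
  forall x y, x != b -> y != b -> adj x y -> c x != c y.
Proof.
move=> ab; have del_col : colorable (del_vertex b) k.-1.
  case: G_crit => _ /(_ b); rewrite /chromatic_number; case: ex_minnP => n n_col _.
  by move=> lt_n; apply: colorableW n_col; rewrite -ltnS (ltn_predK lt_n).
case/existsP: del_col => c /forallP c_col.
have mem x : x != b -> x \in [set~ b] by rewrite !inE.
pose proj x : del_vertex b := insubd (exist _ a (mem a ab)) x.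
exists (c \o proj) => x y xb yb xy /=.
move/forallP: (c_col (proj x)) => /(_ (proj y))/implyP; apply.
by rewrite /= /induced_adj /= !val_insubd !mem.
Qed.

(* Colour [G] minus a vertex of [B] and [G] minus a vertex of [A]. Whichever
   uses fewer colours outside [X] leaves enough colours to recolour the part
   of [X] that it misses. *)
Lemma critical_coclosed_connected (X A : {set G}) a :
  coclosed X -> A \subset X -> a \in A ->
  (forall x y, x \in A -> y \in X -> adj x y -> y \in A) -> A = X.
Proof.
move=> clX sAX aA clA; apply/eqP; rewrite eqEsubset sAX /=.
apply/subsetP=> b bX; apply/negPn/negP=> bA.
have ab : a != b by apply: contraNneq bA => <-.
have [c1 c1P] := critical_del_coloring ab.
have ba : b != a by rewrite eq_sym.
have [c2 c2P] := critical_del_coloring ba.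
(* Here [P] will be [A] or its complement; [cp] and [cq] may fail only at [p] and [q]. *)
have glue (P : pred G) p q (cp cq : G -> 'I_k.-1) :
    (forall x y, x \in X -> y \in X -> P x -> ~~ P y -> ~~ adj x y) ->
    p \in X -> ~~ P p -> q \in X -> P q ->
    (forall x y, x != p -> y != p -> adj x y -> cp x != cp y) ->
    (forall x y, x != q -> y != q -> adj x y -> cq x != cq y) ->
    #|cp @: ~: X| <= #|cq @: ~: X| -> False.
  move=> sepP pX pP qX qP cpP cqP le_col.
  have : #|~: (cq @: ~: X)| <= #|~: (cp @: ~: X)|.
    by move: (cardsC (cp @: ~: X)) (cardsC (cq @: ~: X)) le_col; lia.
  move=> /exists_injection_in[f [fB f_inj]].
  have joinX x y : x \in X -> y \notin X -> adj x y.
    by move=> xX; apply: contraNT => nxy; apply: clX xX nxy.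
  have cqX y : y \in X -> ~~ P y -> cq y \in ~: (cq @: ~: X).
    move=> yX yP; rewrite inE; apply/negP=> /imsetP[z]; rewrite inE => zX eq_c.
    have := joinX y z yX zX; move/(cqP y z); rewrite eq_c eqxx => H.
    by suff: false by []; apply: H; [apply: contraNneq yP|apply: contraNneq zX] => ->.
  (* The bad vertex [p] of [cp] gets its colour from [cq], and the bad vertex [q] of [cq] gets it
     from [cp]. *)
  pose c x := if (x \in X) && ~~ P x then f (cq x) else cp x.
  have c_sym x y : adj x y -> (x \in X) && ~~ P x -> c x != c y.
    move=> xy xR; rewrite /c xR; case/andP: xR => xX xP.
    have [/andP[yX yP]|yR] := ifPn.
      have /eqP nc : cq x != cq y.
        by apply: cqP xy; [apply: contraNneq xP|apply: contraNneq yP] => ->.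
      by apply/eqP=> /f_inj eq_c; apply: nc; apply: eq_c; apply: cqX.
    have yX : y \notin X.
      apply: contraL xy => yX; rewrite yX negbK in yR; rewrite adj_sym.
      exact: sepP.
    apply: contraTneq (fB _ (cqX _ xX xP)) => ->.
    by rewrite inE negbK imset_f // inE.
  have: colorable G k.-1.
    apply/existsP; exists [ffun x => c x]; apply/forallP=> x; apply/forallP=> y.
    apply/implyP=> xy; rewrite !ffunE.
    have [xR|xR] := boolP ((x \in X) && ~~ P x); first exact: c_sym.
    have [yR|yR] := boolP ((y \in X) && ~~ P y).
      by rewrite eq_sym; apply: c_sym; rewrite // adj_sym.
    rewrite /c (negbTE xR) (negbTE yR); apply: cpP xy.
      by apply: contraNneq xR => ->; rewrite pX.
    by apply: contraNneq yR => ->; rewrite pX.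
  (* The existence of a colour [cp p] shows [k.-1] to be positive, so [k <= k.-1] is absurd. *)
  by move/critical_not_colorable; have := ltn_ord (cp p); lia.
have aX := subsetP sAX a aA.
have [le12|/ltnW le21] := leqP #|c1 @: ~: X| #|c2 @: ~: X|.
  apply: (glue (mem A) b a c1 c2) => // x y xX yX xA.
  by apply: contra; apply: clA.
apply: (glue (predC (mem A)) a b c2 c1) => //= [x y xX yX xA|]; rewrite ?negbK //.
by move=> yA; rewrite adj_sym; apply: contra xA => yx; apply: clA yx.
Qed.

Lemma critical_card_bound :
  is_free (path_graph 5) G ->
  is_free (disjoint_union (biclique 1 4) (path_graph 1)) G ->
  #|G| <= k * (k * (k.*2 * 2 ^ (k.+1 + 4)).*2).+1 ^ 3.
Proof.
move=> P5f starf.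
have omega (Q : {set G}) : clique Q -> #|Q| <= k by apply: card_clique_colorable critical_colorable.
rewrite leqNgt -cardsT; apply/negP => /greedy_clique[|Q _ [/omega]]; last first.
  by move=> le_Q card_Q; rewrite card_Q ltnn in le_Q.
move=> v _; set X := coball k.*2 v.
have vX : v \in X by apply: coball_center.
have clX : coclosed X.
  have [//|[Q _ [/omega le_Q card_Q]]] := coball_closed_or_clique v k.
  by rewrite card_Q ltnn in le_Q.
have near (x y : G) : ~~ adj x y -> #|nbr y :\: nbr x| <= 2 ^ (k.+1 + 4).
  exact: star_free_nbrD.
have deg : {in X, forall u, #|nbr u :&: X| <= k * (k.*2 * 2 ^ (k.+1 + 4)).*2}.
  by move=> u; apply: coball_degree.
apply: leq_trans (card_ball 3 vX deg); apply: subset_leq_card.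
(* By $P_5$-freeness this ball is closed under adjacency within [X], so criticality makes it all of
   [X]. *)
have -> : ball X 3 v = X.
  apply: (@critical_coclosed_connected X _ v) => //.
  - exact: ball_sub.
  - exact: ball_center.
  move=> x y xB yX xy; apply: (subsetP (P5_free_ball vX P5f)).
  exact: ball_step xB yX xy.
(* All non-neighbours of [v] lie in [X]. *)
by apply/subsetP=> y; rewrite !inE andbT; apply: clX.
Qed.

End Critical.

(** * Enumeration of graphs of bounded order *)

Section EdgeGraph.
Variables (n : nat) (E : {set 'I_n * 'I_n}).

(** Symmetrising and dropping the diagonal turns every [E] into a graph, so the codes form a finite
    type. *)
Definition edge_adj : rel 'I_n :=
  [rel x y | (x != y) && (((x, y) \in E) || ((y, x) \in E))].

Lemma edge_adj_sym : symmetric edge_adj.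
Proof. by move=> x y; rewrite /edge_adj /= eq_sym orbC. Qed.

Lemma edge_adj_irr : irreflexive edge_adj.
Proof. by move=> x; rewrite /edge_adj /= eqxx. Qed.

Definition edge_graph := SGraph edge_adj_sym edge_adj_irr.
End EdgeGraph.

Lemma bounded_finitely_many (N : nat) :
  finitely_many_up_to_iso (fun G : sgraph => #|G| <= N).
Proof.
pose T : finType := {i : 'I_N.+1 & {set 'I_i * 'I_i}}.
exists #|T|, (fun i => let t : T := enum_val i in edge_graph (tagged t)) => G le_G.
(* The bound [#|G| <= N] is by definition [#|G| < N.+1]. *)
pose n : 'I_N.+1 := @Ordinal N.+1 #|G| le_G.
pose E : {set 'I_n * 'I_n} := [set p | adj (enum_val p.1) (enum_val p.2) ].
pose t : T := Tagged (fun i : 'I_N.+1 => {set 'I_i * 'I_i}) E.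
exists (enum_rank t); rewrite enum_rankK /=.
exists (enum_rank : G -> 'I_n).
  by exists enum_val; [apply: enum_rankK | apply: enum_valK].
move=> x y; rewrite /= /edge_adj /= !inE /= !enum_rankK [adj y x]adj_sym orbb.
rewrite (inj_eq enum_rank_inj).
by case: eqP => // ->; rewrite adj_irr.
Qed.

Theorem theorem2 (k : nat) (hk : 1 <= k) :
  finitely_many_up_to_iso (fun G : sgraph =>
    vertex_critical k G /\
    is_free (path_graph 5) G /\
    is_free (disjoint_union (biclique 1 4) (path_graph 1)) G).
Proof.
have [n [F F_all]] :=
  bounded_finitely_many (k * (k * (k.*2 * 2 ^ (k.+1 + 4)).*2).+1 ^ 3).
exists n, F => G [G_crit [P5f starf]]; apply: F_all.
exact: critical_card_bound.
Qed.
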